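(* For every fixed $r>0$, the function $s \mapsto \theta_o(rs)\,\theta_o(r/s)$, $s>0$, attains its maximum at $s=1$.
   Context: For $s>0$, $\theta_o(s) = \sum_{k\in\mathbb{Z}} e^{-\pi (2k+1)^2 s}$. *)

(* Defs.v *)
From Stdlib Require Import Reals ZArith List Classical ClassicalEpsilon.
Open Scope R_scope.

Definition theta_o_term (s : R) (k : Z) : R :=
  exp (- PI * (IZR (2 * k + 1))^2 * s).

Definition theta_o_partial (s : R) (N : nat) : R :=
  fold_right Rplus 0
    (map (theta_o_term s)
       (map (fun i : nat => (Z.of_nat i - Z.of_nat N)%Z) (seq 0 (2 * N + 1)))).

(* theta_o(s) = sum_{k in Z} e^{-pi (2k+1)^2 s}: the limit of the symmetric
   partial sums (the series converges absolutely for s > 0, so this is the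
   bilateral sum). Chosen by classical description. *)
Definition theta_o (s : R) : R :=
  epsilon (inhabits 0) (fun v => Un_cv (theta_o_partial s) v).

(* Main.v *)
Require Import Defs.
From Stdlib Require Import Reals ZArith List Classical ClassicalEpsilon Lra Lia.
From Coquelicot Require Import Coquelicot.
Open Scope R_scope.

(** The claim is log-concavity of [theta_o] in the variable [log s]. Jacobi's
    transformation gives [sqrt s * theta_o s = C * theta_4], where
    [theta_4 = sum_j (-1)^j q^(j^2)] with [q = exp (- PI / (4 s))], and Gauss'
    identity factors [theta_4] as the product of [(1 - q^k) / (1 + q^k)], that is of
    [tanh (k PI / (8 s))]. Each factor satisfies [tanh A * tanh B <= tanh (sqrt (A B)) ^ 2],
    because [z |-> cosh (sqrt z)] is convex, and the factor [sqrt s] cancels in the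
    product over [r s] and [r / s].

    The transformation is obtained by Polya's method: the transition probabilities of
    the simple random walk on a cycle are computed both by periodizing binomial
    coefficients and by finite Fourier inversion, and the cycle length grows like the
    square root of the number of steps. The constant [C] never has to be evaluated.
    Gauss' identity follows from Shanks' telescoping finite form. *)

(** * Random walk on a cycle *)

(* [walk m a = binomial (2 m) (m + a) / 4 ^ m] *)
Fixpoint walk (m : nat) (a : Z) : R :=
  match m with
  | O => if Z.eqb a 0 then 1 else 0
  | S m => (walk m (a - 1) + 2 * walk m a + walk m (a + 1)) / 4
  end.

Lemma walk_opp m a : walk m (- a) = walk m a.
Proof.
  revert a; induction m as [|m IH]; intro a; cbn [walk].
  - destruct (Z.eqb_spec (- a) 0), (Z.eqb_spec a 0); lia || reflexivity.
  - replace (- a - 1)%Z with (- (a + 1))%Z by lia.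
    replace (- a + 1)%Z with (- (a - 1))%Z by lia.
    rewrite !IH; lra.
Qed.

Lemma walk_out m a : (Z.of_nat m < Z.abs a)%Z -> walk m a = 0.
Proof.
  revert a; induction m as [|m IH]; intros a Ha; cbn [walk].
  - destruct (Z.eqb_spec a 0); [lia | reflexivity].
  - rewrite !IH by lia; lra.
Qed.

(** Quotient of neighbouring binomial coefficients, cleared of denominators so that it holds for
    every integer [a]. Under Pascal's rule the case [S m] is a linear combination of the instances
    at [a - 1], [a] and [a + 1]. *)
Lemma walk_ratio m a :
  walk m (a + 1) * (INR m + IZR a + 1) = walk m a * (INR m - IZR a).
Proof.
  revert a; induction m as [|m IH]; intro a.
  - cbn [walk INR].
    destruct (Z.eqb_spec (a + 1) 0), (Z.eqb_spec a 0); try lia.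
    + replace a with (-1)%Z by lia. lra.
    + subst a; lra.
    + lra.
  - cbn [walk]. rewrite S_INR.
    pose proof (IH a) as H0. pose proof (IH (a + 1)%Z) as H1.
    pose proof (IH (a - 1)%Z) as H2.
    replace (a - 1 + 1)%Z with a in H2 by lia.
    replace (a + 1 - 1)%Z with a by lia.
    rewrite plus_IZR in H1; rewrite minus_IZR in H2. nra.
Qed.

Lemma walk_nonneg m a : 0 <= walk m a.
Proof.
  revert a; induction m as [|m IH]; intro a; cbn [walk].
  - destruct (Z.eqb a 0); lra.
  - pose proof (IH (a - 1)%Z); pose proof (IH a); pose proof (IH (a + 1)%Z); lra.
Qed.

Lemma walk0_S m : walk (S m) 0 = walk m 0 * ((2 * INR m + 1) / (2 * INR m + 2)).
Proof.
  pose proof (walk_ratio m 0) as H; cbn [walk].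
  replace (0 - 1)%Z with (- (1))%Z by lia. rewrite walk_opp.
  replace (0 + 1)%Z with 1%Z in * by lia.
  pose proof (pos_INR m).
  assert (E : walk m 1 = walk m 0 * (INR m / (INR m + 1))).
  { apply (Rmult_eq_reg_r (INR m + 1)); [|lra].
    transitivity (walk m 0 * INR m); [lra | field; lra]. }
  rewrite E; field; lra.
Qed.

(** The quantity [m * walk m 0 ^ 2] increases with [m], since [(x + 1) * ((2 x + 1) / (2 x + 2)) ^ 2
    = x + 1 / (4 (x + 1))], and it starts at [1 / 4] for [m = 1]. This later keeps the constant of
    Jacobi's transformation away from zero. *)
Lemma walk0_lower m : 1 <= 4 * (INR (S m) * walk (S m) 0 ^ 2).
Proof.
  induction m as [|m IH].
  - cbn; lra.
  - rewrite walk0_S. set (D := walk (S m) 0) in *.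
    rewrite (S_INR (S m)). pose proof (lt_0_INR (S m) ltac:(lia)).
    set (x := INR (S m)) in *.
    replace (4 * ((x + 1) * (D * ((2 * x + 1) / (2 * x + 2))) ^ 2))
      with (4 * (x * D ^ 2) + D ^ 2 / (x + 1)) by (field; lra).
    assert (0 <= D ^ 2 / (x + 1)); [|lra].
    apply Rdiv_le_0_compat; [apply pow2_ge_0 | lra].
Qed.

Lemma walk0_pos m : 0 < walk m 0.
Proof.
  induction m as [|m IH]; [cbn; lra|].
  rewrite walk0_S. pose proof (pos_INR m).
  apply Rmult_lt_0_compat; [exact IH | apply Rdiv_lt_0_compat; lra].
Qed.

(** * Gaussian bounds for binomial coefficients *)

Lemma exp_le x y : x <= y -> exp x <= exp y.
Proof.
  intros [H | ->]; [left; apply exp_increasing; exact H | apply Rle_refl].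
Qed.

Lemma one_minus_le_exp y : 1 - y <= exp (- y).
Proof. pose proof (exp_ineq1_le (- y)); lra. Qed.

Lemma exp_le_one_minus y : y < 1 -> exp (- (y / (1 - y))) <= 1 - y.
Proof.
  intro Hy. pose proof (exp_ineq1_le (y / (1 - y))) as H.
  replace (1 + y / (1 - y)) with (/ (1 - y)) in H by (field; lra).
  rewrite exp_Ropp. apply Rle_trans with (/ / (1 - y)); [|rewrite Rinv_inv; lra].
  apply Rinv_le_contravar; [apply Rinv_0_lt_compat; lra | exact H].
Qed.

Lemma walk_succ m (a : nat) :
  walk m (Z.of_nat (S a)) =
  walk m (Z.of_nat a) * ((INR m - INR a) / (INR m + INR a + 1)).
Proof.
  pose proof (walk_ratio m (Z.of_nat a)) as H.
  rewrite <- INR_IZR_INZ in H. rewrite Nat2Z.inj_succ.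
  pose proof (pos_INR m). pose proof (pos_INR a).
  apply (Rmult_eq_reg_r (INR m + INR a + 1)); [|lra].
  unfold Z.succ; rewrite H; field; lra.
Qed.

(** Each quotient [1 - (2 i + 1) / (m + i + 1)] is at most [exp (- (2 i + 1) / (m + A))], and the
    odd numbers below [2 a] add up to [a ^ 2]. The separate bound [A] fixes the denominator during
    the induction; [A = a] gives the sharp limit and [A = m] a uniform majorant. *)
Lemma walk_upper m (A a : nat) : (0 < m)%nat -> (a <= A)%nat -> (a <= m)%nat ->
  walk m (Z.of_nat a) <= walk m 0 * exp (- (INR a ^ 2 / (INR m + INR A))).
Proof.
  intros Hm. induction a as [|a IH]; intros HA Ha.
  - replace (- (INR 0 ^ 2 / (INR m + INR A))) with 0 by (cbn; unfold Rdiv; ring).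
    rewrite exp_0; cbn; lra.
  - rewrite walk_succ. apply le_INR in HA as HA'. apply le_INR in Ha as Ha'.
    rewrite S_INR in *. pose proof (pos_INR a). pose proof (pos_INR m).
    apply Rle_trans with ((walk m 0 * exp (- (INR a ^ 2 / (INR m + INR A)))) *
        exp (- ((2 * INR a + 1) / (INR m + INR A)))).
    + apply Rmult_le_compat; [apply walk_nonneg | | apply IH; lia |].
      * apply Rdiv_le_0_compat; lra.
      * replace ((INR m - INR a) / (INR m + INR a + 1))
          with (1 - (2 * INR a + 1) / (INR m + INR a + 1)) by (field; lra).
        eapply Rle_trans; [apply one_minus_le_exp|].
        apply exp_le, Ropp_le_contravar.
        apply Rmult_le_compat_l; [lra|]. apply Rinv_le_contravar; lra.
    + rewrite Rmult_assoc, <- exp_plus. right; f_equal; f_equal. field; lra.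
Qed.

(** The same product, bounded from below by [1 - y >= exp (- y / (1 - y))]; for
    [y = (2 i + 1) / (m + i + 1)] one has [y / (1 - y) = (2 i + 1) / (m - i)]. *)
Lemma walk_lower m (A a : nat) : (A < m)%nat -> (a <= A)%nat ->
  walk m 0 * exp (- (INR a ^ 2 / (INR m - INR A))) <= walk m (Z.of_nat a).
Proof.
  intros Hm. apply lt_INR in Hm as Hm'. induction a as [|a IH]; intros HA.
  - replace (- (INR 0 ^ 2 / (INR m - INR A))) with 0 by (cbn; unfold Rdiv; ring).
    rewrite exp_0; cbn; lra.
  - rewrite walk_succ. apply le_INR in HA as HA'.
    rewrite S_INR in *. pose proof (pos_INR a). pose proof (pos_INR m).
    apply Rle_trans with ((walk m 0 * exp (- (INR a ^ 2 / (INR m - INR A)))) *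
        exp (- ((2 * INR a + 1) / (INR m - INR A)))).
    + right; rewrite Rmult_assoc, <- exp_plus. f_equal; f_equal. field; lra.
    + apply Rmult_le_compat; [ | left; apply exp_pos | apply IH; lia |].
      * apply Rmult_le_pos; [apply walk_nonneg | left; apply exp_pos].
      * replace ((INR m - INR a) / (INR m + INR a + 1))
          with (1 - (2 * INR a + 1) / (INR m + INR a + 1)) by (field; lra).
        eapply Rle_trans; [|apply exp_le_one_minus].
        -- apply exp_le, Ropp_le_contravar.
           replace ((2 * INR a + 1) / (INR m + INR a + 1) /
             (1 - (2 * INR a + 1) / (INR m + INR a + 1)))
             with ((2 * INR a + 1) / (INR m - INR a)) by (field; lra).
           apply Rmult_le_compat_l; [lra|]. apply Rinv_le_contravar; lra.
        -- apply (Rmult_lt_reg_r (INR m + INR a + 1)); [lra|].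
           unfold Rdiv; rewrite Rmult_assoc, Rinv_l; lra.
Qed.

(** * Periodization and finite Fourier inversion *)

Fixpoint bisum (F : Z -> R) (N : nat) : R :=
  match N with
  | O => F 0%Z
  | S N => bisum F N + F (Z.of_nat (S N)) + F (- Z.of_nat (S N))%Z
  end.

Lemma bisum_ext F G N : (forall k, F k = G k) -> bisum F N = bisum G N.
Proof. intro H; induction N as [|N IH]; cbn [bisum]; rewrite ?IH, !H; reflexivity. Qed.

Lemma bisum_lin F G H N :
  bisum (fun k => (F k + 2 * G k + H k) / 4) N = (bisum F N + 2 * bisum G N + bisum H N) / 4.
Proof. induction N as [|N IH]; cbn [bisum]; [|rewrite IH]; lra. Qed.

Lemma bisum_zero F N : (forall k, (Z.abs k <= Z.of_nat N)%Z -> F k = 0) -> bisum F N = 0.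
Proof.
  induction N as [|N IH]; intro H; cbn [bisum].
  - apply H; lia.
  - rewrite IH, !H; [lra | lia | lia | intros; apply H; lia].
Qed.

Lemma bisum_single F c N : (Z.abs c <= Z.of_nat N)%Z ->
  (forall k, k <> c -> F k = 0) -> bisum F N = F c.
Proof.
  intros Hc H. induction N as [|N IH]; cbn [bisum].
  - replace c with 0%Z by lia; reflexivity.
  - destruct (Z.eq_dec c (Z.of_nat (S N))) as [e|n1];
      [|destruct (Z.eq_dec c (- Z.of_nat (S N))) as [e|n2]].
    + rewrite bisum_zero by (intros; apply H; lia).
      rewrite <- e, (H (- c)%Z) by lia; lra.
    + rewrite bisum_zero by (intros; apply H; lia).
      rewrite <- e, (H (Z.of_nat (S N))) by lia; lra.
    + rewrite IH, (H (Z.of_nat (S N))), (H (- Z.of_nat (S N))%Z) by lia; lra.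
Qed.

(** The reflection about [-1/2] pairs [k] with [- k - 1]. In the range from [- N] to [N] only the
    index [N] has no partner, hence the subtracted term. *)
Lemma bisum_reflect F N : (forall k, F (- (k + 1))%Z = F k) ->
  bisum F N = 2 * sum_f_R0 (fun k => F (Z.of_nat k)) N - F (Z.of_nat N).
Proof.
  intro H; induction N as [|N IH]; cbn [bisum sum_f_R0].
  - cbn; lra.
  - rewrite IH. replace (- Z.of_nat (S N))%Z with (- (Z.of_nat N + 1))%Z by lia.
    rewrite H; lra.
Qed.

(** The function [a |-> cos (x a)] is an eigenvector of one step of the walk, with eigenvalue
    [(1 + cos x) / 2 = cos (x / 2) ^ 2]; this is its evolution over [m] steps. *)
Definition mode (m : nat) (x : R) (a : Z) : R := cos (x / 2) ^ (2 * m) * cos (x * IZR a).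

Lemma mode_S m x a :
  mode (S m) x a = (mode m x (a - 1) + 2 * mode m x a + mode m x (a + 1)) / 4.
Proof.
  unfold mode. rewrite minus_IZR, plus_IZR.
  replace (2 * S m)%nat with (2 + 2 * m)%nat by lia. rewrite pow_add.
  replace (x * (IZR a - 1)) with (x * IZR a - x) by ring.
  replace (x * (IZR a + 1)) with (x * IZR a + x) by ring.
  rewrite cos_minus, cos_plus.
  assert (E : cos x = 2 * cos (x / 2) ^ 2 - 1).
  { replace x with (2 * (x / 2)) at 1 by field. rewrite cos_2a_cos; ring. }
  rewrite E. generalize (cos (x / 2) ^ (2 * m)); intro p; field.
Qed.

(** Real form of Fourier inversion on the cycle of length [2 (l + 1)]. Opposite frequencies are
    merged, whence the factor 2; the self-opposite frequencies [0] and [PI] count only once. *)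
Definition modes (l m : nat) (a : Z) : R :=
  (2 * sum_f_R0 (fun j => mode m (PI * INR j / INR (S l)) a) l - mode m 0 a + mode m PI a)
  / (2 * INR (S l)).

Lemma modes_S l m a :
  modes l (S m) a = (modes l m (a - 1) + 2 * modes l m a + modes l m (a + 1)) / 4.
Proof.
  unfold modes.
  rewrite (sum_eq _ (fun j => (mode m (PI * INR j / INR (S l)) (a - 1) +
    2 * mode m (PI * INR j / INR (S l)) a + mode m (PI * INR j / INR (S l)) (a + 1)) / 4))
    by (intros; apply mode_S).
  rewrite (mode_S m 0), (mode_S m PI).
  assert (E : forall f g h n, sum_f_R0 (fun j => (f j + 2 * g j + h j) / 4) n =
     (sum_f_R0 f n + 2 * sum_f_R0 g n + sum_f_R0 h n) / 4).
  { intros f g h n; induction n as [|n IH]; cbn [sum_f_R0]; [|rewrite IH]; lra. }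
  rewrite E. pose proof (lt_0_INR (S l) ltac:(lia)). field; lra.
Qed.

Lemma dirichlet_kernel x n :
  sin (x / 2) * (2 * sum_f_R0 (fun j => cos (x * INR j)) n - 1) = sin (x * INR n + x / 2).
Proof.
  induction n as [|n IH].
  - cbn [sum_f_R0 INR]. rewrite Rmult_0_r, cos_0, Rplus_0_l. ring.
  - cbn [sum_f_R0]. rewrite S_INR.
    rewrite sin_plus.
    replace (x * INR n + x / 2) with (x * (INR n + 1) - x / 2) in IH by field.
    rewrite sin_minus in IH. lra.
Qed.

Lemma cos_2PI_IZR k : cos (2 * PI * IZR k) = 1.
Proof.
  replace (2 * PI * IZR k) with (2 * (PI * IZR k)) by ring.
  rewrite cos_2a_sin. rewrite (sin_eq_0_1 (PI * IZR k)); [ring|].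
  exists k; ring.
Qed.

Lemma modes_0_dvd l k : modes l 0 (2 * Z.of_nat (S l) * k) = 1.
Proof.
  unfold modes, mode. cbn [Nat.mul Nat.add pow].
  pose proof (lt_0_INR (S l) ltac:(lia)) as Hl.
  rewrite (sum_eq _ (fun _ => 1)).
  - rewrite sum_cte, Rmult_0_l, cos_0.
    replace (PI * IZR (2 * Z.of_nat (S l) * k)) with (2 * PI * IZR (Z.of_nat (S l) * k)).
    + rewrite cos_2PI_IZR; field; lra.
    + rewrite !mult_IZR; ring.
  - intros j _. rewrite Rmult_1_l.
    rewrite <- (cos_2PI_IZR (Z.of_nat j * k)). f_equal.
    rewrite !mult_IZR, <- !INR_IZR_INZ. field; lra.
Qed.

(** Orthogonality of characters. With [x = PI a / (l + 1)] the Dirichlet kernel is evaluated at [sin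
    (PI a - x / 2) = - cos (PI a) * sin (x / 2)], so after division by [sin (x / 2)] the sum cancels
    the mode at [PI]. A zero of [sin (x / 2)] would make [a] a multiple of the cycle length. *)
Lemma modes_0_ndvd l a : (forall k, a <> (2 * Z.of_nat (S l) * k)%Z) -> modes l 0 a = 0.
Proof.
  intro Ha. unfold modes, mode. cbn [Nat.mul Nat.add pow].
  pose proof (lt_0_INR (S l) ltac:(lia)) as Hl.
  set (x := PI * IZR a / INR (S l)).
  rewrite (sum_eq _ (fun j => cos (x * INR j))).
  2:{ intros j _. rewrite Rmult_1_l; f_equal. unfold x; field; lra. }
  rewrite Rmult_0_l, cos_0, !Rmult_1_l.
  assert (Hs : sin (x / 2) <> 0).
  { intro H; apply sin_eq_0_0 in H as [k Hk]. apply (Ha k).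
    apply eq_IZR. rewrite !mult_IZR, <- INR_IZR_INZ.
    apply (Rmult_eq_reg_l PI); [|apply PI_neq0].
    unfold x in Hk. apply (f_equal (fun y => y * (2 * INR (S l)))) in Hk.
    replace (PI * IZR a / INR (S l) / 2 * (2 * INR (S l))) with (PI * IZR a) in Hk
      by (field; lra).
    rewrite Hk; ring. }
  pose proof (dirichlet_kernel x l) as D.
  replace (x * INR l + x / 2) with (PI * IZR a - x / 2) in D.
  2:{ unfold x; rewrite S_INR in *. field; lra. }
  rewrite sin_minus in D. rewrite (sin_eq_0_1 (PI * IZR a)) in D by (exists a; ring).
  assert (E : 2 * sum_f_R0 (fun j => cos (x * INR j)) l - 1 = - cos (PI * IZR a)).
  { apply (Rmult_eq_reg_l (sin (x / 2))); [lra | exact Hs]. }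
  rewrite E. unfold Rdiv; ring.
Qed.

(** Both sides obey the recurrence of the walk in [m] and both start as the indicator of the
    multiples of the cycle length. The bound on [K] ensures that the truncated sum loses no nonzero
    term. *)
Lemma periodized_walk l m K a :
  (Z.abs a + Z.of_nat m <= 2 * Z.of_nat (S l) * Z.of_nat K)%Z ->
  bisum (fun k => walk m (a + 2 * Z.of_nat (S l) * k)) K = modes l m a.
Proof.
  revert a; induction m as [|m IH]; intros a Ha.
  - destruct (classic (exists k, a = (2 * Z.of_nat (S l) * k)%Z)) as [[k ->] | H].
    + rewrite modes_0_dvd. rewrite (bisum_single _ (- k)).
      * cbn [walk]. destruct (Z.eqb_spec (2 * Z.of_nat (S l) * k + 2 * Z.of_nat (S l) * - k) 0);
          [reflexivity | lia].
      * nia.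
      * intros k' Hk'. cbn [walk].
        destruct (Z.eqb_spec (2 * Z.of_nat (S l) * k + 2 * Z.of_nat (S l) * k') 0); [nia | reflexivity].
    + rewrite modes_0_ndvd by (intros k Hk; apply H; exists k; exact Hk).
      apply bisum_zero. intros k _. cbn [walk].
      destruct (Z.eqb_spec (a + 2 * Z.of_nat (S l) * k) 0); [|reflexivity].
      exfalso; apply H; exists (- k)%Z; lia.
  - rewrite modes_S, <- !IH by lia. rewrite <- bisum_lin.
    apply bisum_ext; intro k; cbn [walk].
    replace (a + 2 * Z.of_nat (S l) * k - 1)%Z with (a - 1 + 2 * Z.of_nat (S l) * k)%Z by lia.
    replace (a + 2 * Z.of_nat (S l) * k + 1)%Z with (a + 1 + 2 * Z.of_nat (S l) * k)%Z by lia.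
    reflexivity.
Qed.

Lemma cos_PI_INR j : cos (PI * INR j) = (-1) ^ j.
Proof.
  induction j as [|j IH]; [cbn; rewrite Rmult_0_r; apply cos_0|].
  rewrite S_INR, Rmult_plus_distr_l, Rmult_1_r, neg_cos, IH. cbn; ring.
Qed.

(* [periodized_walk] at the antipode of the starting point on the cycle of
   length [2 (l + 1)]; there the mode [j] contributes the sign [(-1) ^ j]. *)
Lemma polya_identity l m : (0 < m)%nat ->
  2 * INR (S l) * (2 * sum_f_R0 (fun k => walk m (Z.of_nat (S l * (2 * k + 1)))) (S m)) =
  2 * sum_f_R0 (fun j => (-1) ^ j * cos (PI * INR j / (2 * INR (S l))) ^ (2 * m)) l - 1.
Proof.
  intro Hm. pose proof (lt_0_INR (S l) ltac:(lia)) as Hl.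
  pose proof (periodized_walk l m (S m) (Z.of_nat (S l)) ltac:(lia)) as P.
  rewrite bisum_reflect in P.
  2:{ intro k. rewrite <- walk_opp. f_equal. lia. }
  (* The unpaired end term left by [bisum_reflect] lies beyond the reach of [m] steps. *)
  rewrite (walk_out m (Z.of_nat (S l) + 2 * Z.of_nat (S l) * Z.of_nat (S m))) in P by lia.
  rewrite (sum_eq _ (fun k => walk m (Z.of_nat (S l * (2 * k + 1))))) in P.
  2:{ intros k _; f_equal. lia. }
  rewrite Rminus_0_r in P. rewrite P. unfold modes, mode.
  (* The mode at frequency [PI] vanishes because [m > 0]. *)
  rewrite <- INR_IZR_INZ. rewrite cos_PI2, pow_i by lia.
  replace (0 / 2) with 0 by field. rewrite Rmult_0_l, cos_0, pow1.
  rewrite (sum_eq _ (fun j => (-1) ^ j * cos (PI * INR j / (2 * INR (S l))) ^ (2 * m))).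
  - field; lra.
  - intros j _. rewrite Rmult_comm. f_equal.
    + rewrite <- cos_PI_INR; f_equal; field; lra.
    + f_equal; f_equal; field; lra.
Qed.

(** * Hyperbolic inequality and Gauss' product *)

Lemma nondecreasing_of_derive (f df : R -> R) a b : a <= b ->
  (forall x, a <= x <= b -> is_derive f x (df x)) ->
  (forall x, a <= x <= b -> 0 <= df x) -> f a <= f b.
Proof.
  intros Hab Hd Hp.
  destruct (MVT_gen f a b df) as [c [Hc E]].
  - intros x; rewrite Rmin_left, Rmax_right by lra; intros; apply Hd; lra.
  - intros x; rewrite Rmin_left, Rmax_right by lra; intros.
    apply continuity_pt_filterlim, (ex_derive_continuous f x).
    eexists; apply Hd; lra.
  - rewrite Rmin_left, Rmax_right in Hc by lra.
    pose proof (Hp c ltac:(lra)). nra.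
Qed.

Lemma is_derive_cosh x : is_derive cosh x (sinh x).
Proof. apply is_derive_Reals, derivable_pt_lim_cosh. Qed.

Lemma is_derive_sinh x : is_derive sinh x (cosh x).
Proof. apply is_derive_Reals, derivable_pt_lim_sinh. Qed.

Lemma cosh_even x : cosh (- x) = cosh x.
Proof. unfold cosh; rewrite Ropp_involutive; lra. Qed.

Lemma sinh_nonneg x : 0 <= x -> 0 <= sinh x.
Proof. intros [H | <-]; [pose proof (sinh_lt 0 x H)|]; rewrite sinh_0 in *; lra. Qed.

Lemma sinh_le_mul_cosh x : 0 <= x -> sinh x <= x * cosh x.
Proof.
  intro Hx.
  pose proof (nondecreasing_of_derive (fun t => t * cosh t - sinh t) (fun t => t * sinh t) 0 x Hx) as H.
  cbv beta in H. rewrite sinh_0 in H.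
  enough (0 * cosh 0 - 0 <= x * cosh x - sinh x) by lra. apply H.
  - intros t _. evar_last.
    + apply (is_derive_minus (fun t => t * cosh t) sinh).
      * apply (is_derive_mult (fun t => t) cosh); [apply is_derive_id | apply is_derive_cosh | intros; apply Rmult_comm].
      * apply is_derive_sinh.
    + cbn. unfold minus, plus, opp, mult, one; cbn. ring.
  - intros t Ht; apply Rmult_le_pos; [lra | apply sinh_nonneg; lra].
Qed.

(** Monotonicity of [sinh t / t], cross-multiplied. Up to a factor [1 / 2] this quotient is the
    derivative of [cosh (sqrt z)] at [z = t ^ 2], so this is the convexity of that function. *)
Lemma sinh_ratio_le y x : 0 <= y <= x -> x * sinh y <= y * sinh x.
Proof.
  intros [Hy Hx].
  pose proof (nondecreasing_of_derive (fun t => y * sinh t - t * sinh y)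
    (fun t => y * cosh t - sinh y) y x Hx) as H. cbv beta in H.
  enough (y * sinh y - y * sinh y <= y * sinh x - x * sinh y) by lra. apply H.
  - intros t _. evar_last.
    + apply (is_derive_minus (fun t => y * sinh t) (fun t => t * sinh y)).
      * apply (is_derive_scal sinh t y), is_derive_sinh.
      * apply (is_derive_scal_l (fun t => t) t 1 (sinh y)).
        auto_derive; [exact I | reflexivity].
    + cbn. unfold minus, plus, opp, scal, mult, one; cbn; unfold mult; cbn. ring.
  - intros t Ht. pose proof (sinh_le_mul_cosh y Hy).
    assert (cosh y <= cosh t); [|nra].
    apply (nondecreasing_of_derive cosh sinh); [lra | intros; apply is_derive_cosh|].
    intros; apply sinh_nonneg; lra.
Qed.

(* Tangent line inequality for the convex function [z |-> cosh (sqrt z)]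
   at [z = S ^ 2], multiplied by [S] *)
Lemma cosh_sqrt_tangent S x : 0 <= S ->
  S * cosh S + sinh S * ((x ^ 2 - S ^ 2) / 2) <= S * cosh x.
Proof.
  intro HS.
  assert (P : forall x, 0 <= x ->
    S * cosh S + sinh S * ((x ^ 2 - S ^ 2) / 2) <= S * cosh x).
  { clear x; intros x Hx.
    assert (D : forall t, is_derive (fun t => S * cosh t - sinh S * (t ^ 2 / 2)) t
                  (S * sinh t - t * sinh S)).
    { intro t. evar_last.
      - apply (is_derive_minus (fun t => S * cosh t) (fun t => sinh S * (t ^ 2 / 2))).
        + apply (is_derive_scal cosh t S), is_derive_cosh.
        + apply (is_derive_scal (fun t => t ^ 2 / 2)). auto_derive; [exact I | reflexivity].
      - cbn. unfold minus, plus, opp, scal, mult, one; cbn. field. }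
    (* The derivative in [D] changes sign from negative to positive at [S], so the function there is
       minimal at [S]; the two cases are the two sides of [S]. *)
    destruct (Rle_dec S x) as [h | h].
    - pose proof (nondecreasing_of_derive _ _ S x h (fun t _ => D t)) as H. cbv beta in H.
      assert (S * cosh S - sinh S * (S ^ 2 / 2) <= S * cosh x - sinh S * (x ^ 2 / 2)); [|lra].
      apply H. intros t Ht. pose proof (sinh_ratio_le S t). lra.
    - pose proof (nondecreasing_of_derive (fun t => - (S * cosh t - sinh S * (t ^ 2 / 2)))
        (fun t => - (S * sinh t - t * sinh S)) x S ltac:(lra)) as H. cbv beta in H.
      assert (- (S * cosh x - sinh S * (x ^ 2 / 2)) <= - (S * cosh S - sinh S * (S ^ 2 / 2))); [|lra].
      apply H.
      + intros t _; apply (is_derive_opp (fun t => S * cosh t - sinh S * (t ^ 2 / 2))), D.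
      + intros t Ht. pose proof (sinh_ratio_le t S). lra. }
  destruct (Rle_dec 0 x) as [h | h]; [apply P, h|].
  rewrite <- (cosh_even x). replace (x ^ 2) with ((- x) ^ 2) by ring. apply P; lra.
Qed.

(** The tangent inequality is added at [x] and [y]; the linear terms cancel because the squares have
    mean [S ^ 2]. *)
Lemma cosh_quadratic_mean S x y : 0 < S -> x ^ 2 + y ^ 2 = 2 * S ^ 2 ->
  2 * cosh S <= cosh x + cosh y.
Proof.
  intros HS E. pose proof (cosh_sqrt_tangent S x ltac:(lra)).
  pose proof (cosh_sqrt_tangent S y ltac:(lra)).
  assert (sinh S * ((x ^ 2 - S ^ 2) / 2) + sinh S * ((y ^ 2 - S ^ 2) / 2) = 0).
  { replace (x ^ 2) with (2 * S ^ 2 - y ^ 2) by lra. field. }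
  apply (Rmult_le_reg_l S); [exact HS | lra].
Qed.

Definition factor (q : R) : R := (1 - q) / (1 + q).

(** Since [factor (exp (- A)) = tanh (A / 2)], product formulas turn the claim into [cosh ((A + B) /
    2) <= cosh ((A - B) / 2) * cosh a]. Twice the right-hand side is [cosh x + cosh y] with
    [x, y = (A - B) / 2 ± a], and [A * B = a ^ 2] makes the mean of their squares
    [((A + B) / 2) ^ 2]. *)
Lemma factor_geometric_mean A B a : 0 < A -> 0 < B -> 0 < a -> A * B = a ^ 2 ->
  factor (exp (- A)) * factor (exp (- B)) <= factor (exp (- a)) ^ 2.
Proof.
  intros HA HB Ha E.
  pose proof (cosh_quadratic_mean ((A + B) / 2) ((A - B) / 2 + a) ((A - B) / 2 - a)
    ltac:(lra) ltac:(nra)) as H.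
  unfold cosh in H.
  assert (EA : exp (- A) = exp (- (A / 2)) * exp (- (A / 2))) by (rewrite <- exp_plus; f_equal; field).
  assert (EB : exp (- B) = exp (- (B / 2)) * exp (- (B / 2))) by (rewrite <- exp_plus; f_equal; field).
  rewrite EA, EB.
  pose proof (exp_pos (- (A / 2))). pose proof (exp_pos (- (B / 2))). pose proof (exp_pos (- a)).
  set (x := exp (- (A / 2))) in *. set (y := exp (- (B / 2))) in *. set (w := exp (- a)) in *.
  replace (exp ((A + B) / 2)) with (/ (x * y)) in H
    by (unfold x, y; rewrite <- exp_plus, <- exp_Ropp; f_equal; field).
  replace (exp (- ((A + B) / 2))) with (x * y) in H
    by (unfold x, y; rewrite <- exp_plus; f_equal; field).
  replace (exp ((A - B) / 2 + a)) with (y * / (x * w)) in H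
    by (unfold x, y, w; rewrite <- exp_plus, <- exp_Ropp, <- exp_plus; f_equal; field).
  replace (exp (- ((A - B) / 2 + a))) with (x * w * / y) in H
    by (unfold x, y, w; rewrite <- exp_plus, <- exp_Ropp, <- exp_plus; f_equal; field).
  replace (exp ((A - B) / 2 - a)) with (y * w * / x) in H
    by (unfold x, y, w; rewrite <- exp_plus, <- exp_Ropp, <- exp_plus; f_equal; field).
  replace (exp (- ((A - B) / 2 - a))) with (x * / (y * w)) in H
    by (unfold x, y, w; rewrite <- exp_plus, <- exp_Ropp, <- exp_plus; f_equal; field).
  (* The hyperbolic inequality multiplied by [2 * x * y * w] becomes polynomial. *)
  assert (K : 2 * w * (1 + x * x * (y * y)) <= (x * x + y * y) * (1 + w * w)).
  { apply (Rmult_le_compat_l (2 * (x * y * w))) in H; [|left; repeat apply Rmult_lt_0_compat; lra].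
    match type of H with ?l <= ?r =>
      replace l with (2 * w * (1 + x * x * (y * y))) in H by (field; lra);
      replace r with ((x * x + y * y) * (1 + w * w)) in H by (field; lra) end.
    exact H. }
  unfold factor.
  assert (0 < x * x) by nra. assert (0 < y * y) by nra.
  set (u := x * x) in *; set (v := y * y) in *; clearbody u v w.
  apply (Rmult_le_reg_r ((1 + u) * (1 + v) * (1 + w) ^ 2)).
  { repeat apply Rmult_lt_0_compat; lra. }
  replace ((1 - u) / (1 + u) * ((1 - v) / (1 + v)) * ((1 + u) * (1 + v) * (1 + w) ^ 2))
    with ((1 - u) * (1 - v) * (1 + w) ^ 2) by (field; lra).
  replace (((1 - w) / (1 + w)) ^ 2 * ((1 + u) * (1 + v) * (1 + w) ^ 2))
    with ((1 + u) * (1 + v) * (1 - w) ^ 2) by (field; lra).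
  (* The right side minus the left side is exactly twice the corresponding difference in [K]. *)
  nra.
Qed.

(** * Gauss' product and Shanks' finite form *)

Fixpoint gauss_prod (q : R) (n : nat) : R :=
  match n with O => 1 | S n => gauss_prod q n * factor (q ^ S n) end.

Lemma pow_unit q n : 0 < q < 1 -> 0 < q ^ S n < 1.
Proof.
  intro H; split; [apply pow_lt; lra|]. cbn.
  pose proof (pow_lt q n ltac:(lra)).
  assert (q ^ n <= 1) by (rewrite <- (pow1 n); apply pow_incr; lra). nra.
Qed.

Lemma factor_unit q : 0 < q < 1 -> 0 < factor q < 1.
Proof.
  intro H; unfold factor; split; [apply Rdiv_lt_0_compat; lra|].
  apply (Rmult_lt_reg_r (1 + q)); [lra|].
  unfold Rdiv; rewrite Rmult_assoc, Rinv_l; lra.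
Qed.

Lemma gauss_prod_pos q n : 0 < q < 1 -> 0 < gauss_prod q n.
Proof.
  intro H; induction n as [|n IH]; cbn [gauss_prod]; [lra|].
  apply Rmult_lt_0_compat; [exact IH | apply factor_unit, pow_unit, H].
Qed.

Lemma gauss_prod_decr q k n : 0 < q < 1 -> (k <= n)%nat -> gauss_prod q n <= gauss_prod q k.
Proof.
  intros H Hkn; induction Hkn as [|n _ IH]; [lra|]. cbn [gauss_prod].
  pose proof (gauss_prod_pos q n H). pose proof (factor_unit _ (pow_unit q n H)). nra.
Qed.

Lemma exp_opp_pow x n : exp (- x) ^ n = exp (- (INR n * x)).
Proof.
  induction n as [|n IH].
  - cbn. rewrite Rmult_0_l, Ropp_0, exp_0; reflexivity.
  - cbn [pow]. rewrite IH, <- exp_plus, S_INR. f_equal; ring.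
Qed.

(** The inequality holds factor by factor: the factor of index [k] belongs to [k A], [k B], [k a],
    which satisfy the same relation. *)
Lemma gauss_prod_geometric_mean A B a n : 0 < A -> 0 < B -> 0 < a -> A * B = a ^ 2 ->
  gauss_prod (exp (- A)) n * gauss_prod (exp (- B)) n <= gauss_prod (exp (- a)) n ^ 2.
Proof.
  intros HA HB Ha E.
  assert (U : forall x, 0 < x -> 0 < exp (- x) < 1).
  { intros x Hx; split; [apply exp_pos|]. rewrite <- exp_0; apply exp_increasing; lra. }
  induction n as [|n IH]; cbn [gauss_prod]; [lra|].
  rewrite Rpow_mult_distr.
  replace (gauss_prod (exp (- A)) n * factor (exp (- A) ^ S n) *
           (gauss_prod (exp (- B)) n * factor (exp (- B) ^ S n)))
    with ((gauss_prod (exp (- A)) n * gauss_prod (exp (- B)) n) *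
          (factor (exp (- A) ^ S n) * factor (exp (- B) ^ S n))) by ring.
  apply Rmult_le_compat; [| |exact IH|].
  - left; apply Rmult_lt_0_compat; apply gauss_prod_pos, U; assumption.
  - left; apply Rmult_lt_0_compat; apply factor_unit, pow_unit, U; assumption.
  - rewrite !exp_opp_pow. pose proof (lt_0_INR (S n) ltac:(lia)).
    apply factor_geometric_mean; try (apply Rmult_lt_0_compat; assumption).
    rewrite Rpow_mult_distr, <- E; ring.
Qed.

(** Normalized so that the term [s = 0] equals [gauss_prod q n], while the others carry powers of
    [q ^ S n] and die out as [n] grows. *)
Definition shanks_term (q : R) (n s : nat) : R :=
  (-1) ^ s * (2 * (q ^ S n) ^ s / (1 + q ^ s)) * (gauss_prod q n / gauss_prod q s).

(** Raising [n] by one changes a partial sum only by a boundary term, which telescopes in [k]. *)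
Lemma shanks_telescope q n k : 0 < q < 1 ->
  sum_f_R0 (shanks_term q (S n)) k - sum_f_R0 (shanks_term q n) k =
  (-1) ^ S k * (2 * (q ^ S n) ^ S k / (1 + q ^ S n)) * (gauss_prod q n / gauss_prod q k).
Proof.
  intro H. pose proof (pow_unit q n H).
  induction k as [|k IH].
  - cbn [sum_f_R0]. unfold shanks_term. cbn [gauss_prod]. unfold factor.
    rewrite !pow_O, !pow_1. field; lra.
  - cbn [sum_f_R0].
    match goal with |- ?a + ?b - (?c + ?d) = _ => transitivity ((a - c) + (b - d)); [ring|] end.
    rewrite IH. unfold shanks_term. cbn [gauss_prod]. unfold factor.
    assert (E : (q ^ S (S n)) ^ S k = (q ^ S n) ^ S k * q ^ S k).
    { rewrite <- Rpow_mult_distr. f_equal. cbn; ring. }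
    rewrite E. replace ((q ^ S n) ^ S (S k)) with ((q ^ S n) ^ S k * q ^ S n) by (cbn; ring).
    replace ((-1) ^ S (S k)) with (- (-1) ^ S k) by (cbn; ring).
    pose proof (pow_unit q k H). pose proof (gauss_prod_pos q k H).
    field; lra.
Qed.

(** Put [Q = q ^ S n]. Passing from [n] to [S n], the telescoped change and the new last term
    contribute the shares [1 / (1 + Q)] and [Q / (1 + Q)] of [2 * (-1) ^ S n * Q ^ S n], the new
    term on the left. *)
Lemma shanks_identity q n : 0 < q < 1 ->
  2 * sum_f_R0 (fun j => (-1) ^ j * q ^ (j * j)) n - 1 = sum_f_R0 (shanks_term q n) n.
Proof.
  intro H. induction n as [|n IH].
  - cbn. unfold shanks_term; cbn. field.
  - pose proof (shanks_telescope q n n H) as T. cbn [sum_f_R0].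
    pose proof (pow_unit q n H). pose proof (gauss_prod_pos q n H).
    pose proof (gauss_prod_pos q (S n) H).
    unfold shanks_term at 2.
    replace (q ^ (S n * S n)) with ((q ^ S n) ^ S n) by (rewrite pow_mult; reflexivity).
    replace ((q ^ S (S n)) ^ S n) with ((q ^ S n) ^ S n * q ^ S n)
      by (rewrite <- Rpow_mult_distr; f_equal; cbn; ring).
    replace (gauss_prod q n / gauss_prod q n) with 1 in T by (field; lra).
    replace (gauss_prod q (S n) / gauss_prod q (S n)) with 1 by (field; lra).
    transitivity ((2 * sum_f_R0 (fun j => (-1) ^ j * q ^ (j * j)) n - 1) +
      2 * ((-1) ^ S n * (q ^ S n) ^ S n)); [ring|].
    rewrite IH.
    replace (sum_f_R0 (shanks_term q (S n)) n) with (sum_f_R0 (shanks_term q n) n +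
      (-1) ^ S n * (2 * (q ^ S n) ^ S n / (1 + q ^ S n)) * 1) by lra.
    field; lra.
Qed.

(** The term [s = 0] cancels [gauss_prod q n]. For [1 <= s <= n] the ratio of products is at most 1,
    so the term [s] is at most [2 * (q ^ S n) ^ s]; the bound is the sum of this geometric
    progression. *)
Lemma shanks_error q n k : 0 < q < 1 -> (k <= n)%nat ->
  Rabs (sum_f_R0 (shanks_term q n) k - gauss_prod q n) <=
  2 * q ^ S n * (1 - (q ^ S n) ^ k) / (1 - q ^ S n).
Proof.
  intros H. pose proof (pow_unit q n H). induction k as [|k IH]; intro Hk.
  - cbn [sum_f_R0]. unfold shanks_term. cbn [gauss_prod]. rewrite !pow_O.
    match goal with |- Rabs ?a <= ?b => replace a with 0 by field; replace b with 0 by (field; lra) end.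
    rewrite Rabs_R0; lra.
  - cbn [sum_f_R0]. specialize (IH ltac:(lia)).
    replace (2 * q ^ S n * (1 - (q ^ S n) ^ S k) / (1 - q ^ S n)) with
      (2 * q ^ S n * (1 - (q ^ S n) ^ k) / (1 - q ^ S n) + 2 * (q ^ S n) ^ S k)
      by (cbn [pow]; cbn [pow] in *; field; lra).
    match goal with |- Rabs (?a + ?b - ?c) <= _ =>
      replace (a + b - c) with ((a - c) + b) by ring end.
    eapply Rle_trans; [apply Rabs_triang|]. apply Rplus_le_compat; [exact IH|].
    unfold shanks_term. rewrite !Rabs_mult, pow_1_abs, Rmult_1_l.
    pose proof (pow_unit q k H). pose proof (gauss_prod_pos q (S k) H).
    pose proof (gauss_prod_pos q n H).
    pose proof (pow_lt (q ^ S n) (S k) ltac:(lra)).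
    rewrite <- (Rmult_1_r (2 * (q ^ S n) ^ S k)) at 2.
    rewrite !Rabs_pos_eq.
    + apply Rmult_le_compat.
      * apply Rdiv_le_0_compat; lra.
      * apply Rdiv_le_0_compat; lra.
      * apply (Rmult_le_reg_r (1 + q ^ S k)); [lra|].
        unfold Rdiv; rewrite Rmult_assoc, Rinv_l by lra. nra.
      * apply (Rmult_le_reg_r (gauss_prod q (S k))); [lra|].
        unfold Rdiv; rewrite Rmult_assoc, Rinv_l by lra.
        pose proof (gauss_prod_decr q (S k) n H Hk). lra.
    + apply Rdiv_le_0_compat; lra.
    + apply Rdiv_le_0_compat; lra.
Qed.

(* Gauss: [sum_{j in Z} (-1)^j q^(j^2) = prod_{k >= 1} (1 - q^k) / (1 + q^k)] *)
Lemma gauss_square_product q T : 0 < q < 1 ->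
  is_lim_seq (sum_f_R0 (fun j => (-1) ^ j * q ^ (j * j))) ((T + 1) / 2) ->
  is_lim_seq (gauss_prod q) T.
Proof.
  intros H HT.
  (* The product is the alternating sum minus the Shanks error, and the error is at most
     [2 q / (1 - q) * q ^ n]. *)
  apply (is_lim_seq_ext (fun n => (2 * sum_f_R0 (fun j => (-1) ^ j * q ^ (j * j)) n - 1)
    - (sum_f_R0 (shanks_term q n) n - gauss_prod q n))).
  { intro n; rewrite shanks_identity by exact H; ring. }
  replace (Finite T) with (Finite ((2 * ((T + 1) / 2) - 1) - 0)) by (f_equal; field).
  apply is_lim_seq_minus'.
  - apply is_lim_seq_minus'; [|apply is_lim_seq_const].
    apply is_lim_seq_mult'; [apply is_lim_seq_const | exact HT].
  - apply is_lim_seq_abs_0.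
    apply (is_lim_seq_le_le (fun _ => 0) _ (fun n => (2 * q / (1 - q)) * q ^ n)).
    + intro n; split; [apply Rabs_pos|].
      eapply Rle_trans; [apply shanks_error; [exact H | lia]|].
      pose proof (pow_unit q n H). pose proof (pow_lt (q ^ S n) n ltac:(lra)).
      pose proof (pow_lt q n ltac:(lra)).
      assert (Hq : q ^ S n <= q).
      { cbn. assert (q ^ n <= 1) by (rewrite <- (pow1 n); apply pow_incr; lra). nra. }
      apply Rle_trans with (2 * q ^ S n / (1 - q)); [|right; cbn; field; lra].
      apply Rmult_le_compat.
      * assert ((q ^ S n) ^ n <= 1) by (rewrite <- (pow1 n); apply pow_incr; lra).
        apply Rmult_le_pos; lra.
      * left; apply Rinv_0_lt_compat; lra.
      * nra.
      * apply Rinv_le_contravar; lra.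
    + apply is_lim_seq_const.
    + replace (Finite 0) with (Finite (2 * q / (1 - q) * 0)) by (f_equal; ring).
      apply is_lim_seq_mult'; [apply is_lim_seq_const|].
      apply is_lim_seq_geom. rewrite Rabs_pos_eq; lra.
Qed.

(** * Passage to the limit *)

Lemma is_lim_seq_sum_f_R0 (a : nat -> nat -> R) (l : nat -> R) N :
  (forall k, is_lim_seq (fun n => a n k) (l k)) ->
  is_lim_seq (fun n => sum_f_R0 (a n) N) (sum_f_R0 l N).
Proof.
  intro H; induction N as [|N IH]; cbn [sum_f_R0]; [apply H|].
  apply is_lim_seq_plus'; [exact IH | apply H].
Qed.

Lemma sum_f_R0_tail_le (a M : nat -> R) p n : (p <= n)%nat ->
  (forall k, (k <= n)%nat -> Rabs (a k) <= M k) ->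
  Rabs (sum_f_R0 a n - sum_f_R0 a p) <= sum_f_R0 M n - sum_f_R0 M p.
Proof.
  intros Hpn; induction Hpn as [|n _ IH]; intro H.
  - rewrite !Rminus_diag, Rabs_R0; lra.
  - cbn [sum_f_R0].
    replace (sum_f_R0 a n + a (S n) - sum_f_R0 a p)
      with (sum_f_R0 a n - sum_f_R0 a p + a (S n)) by ring.
    eapply Rle_trans; [apply Rabs_triang|].
    specialize (IH (fun k Hk => H k ltac:(lia))). specialize (H (S n) ltac:(lia)). lra.
Qed.

(** Dominated convergence for sums whose length [K n] also varies: beyond a fixed cut [p] both sums
    are controlled by the tail of [M], and before it the convergence is termwise. *)
Lemma tannery (a : nat -> nat -> R) (l M : nat -> R) (K : nat -> nat) (L S : R) :
  is_lim_seq (sum_f_R0 M) S ->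
  (forall n k, (k <= K n)%nat -> Rabs (a n k) <= M k) ->
  (forall k, Rabs (l k) <= M k) ->
  is_lim_seq (sum_f_R0 l) L ->
  (forall p, eventually (fun n => (p <= K n)%nat)) ->
  (forall k, is_lim_seq (fun n => a n k) (l k)) ->
  is_lim_seq (fun n => sum_f_R0 (a n) (K n)) L.
Proof.
  intros HM Ha Hl HL HK Hlim.
  assert (M0 : forall k, 0 <= M k) by (intro k; eapply Rle_trans; [apply Rabs_pos | apply Hl]).
  assert (MS : forall n, sum_f_R0 M n <= S).
  { apply is_lim_seq_incr_compare; [exact HM|]. intro n; cbn [sum_f_R0]; pose proof (M0 (Datatypes.S n)); lra. }
  apply is_lim_seq_spec. intro eps.
  (* Three errors of at most [eps / 4] arise: the head, the tail of [a n] and the tail of [l]. *)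
  assert (He : 0 < eps / 4) by (destruct eps; cbn; lra).
  apply is_lim_seq_spec in HM. destruct (HM (mkposreal _ He)) as [p Hp].
  specialize (Hp p (Nat.le_refl p)). cbn in Hp. apply Rabs_def2 in Hp.
  assert (T : Rabs (L - sum_f_R0 l p) <= eps / 4).
  { assert (Q : is_lim_seq (fun n => Rabs (sum_f_R0 l n - sum_f_R0 l p)) (Rabs (L - sum_f_R0 l p))).
    { apply (is_lim_seq_abs _ (L - sum_f_R0 l p)).
      apply is_lim_seq_minus'; [exact HL | apply is_lim_seq_const]. }
    refine (is_lim_seq_le_loc _ (fun _ => eps / 4) (Rabs (L - sum_f_R0 l p)) (eps / 4) _ Q (is_lim_seq_const _)).
    exists p; intros n Hn; cbv beta. eapply Rle_trans; [apply (sum_f_R0_tail_le l M); [exact Hn | intros; apply Hl]|].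
    pose proof (MS n). lra. }
  pose proof (is_lim_seq_sum_f_R0 a l p Hlim) as F. apply is_lim_seq_spec in F.
  generalize (filter_and _ _ (F (mkposreal _ He)) (HK p)).
  apply filter_imp. intros n [H1 H2]. cbn in H1.
  pose proof (sum_f_R0_tail_le (a n) M p (K n) H2 (Ha n)) as H3. pose proof (MS (K n)).
  replace (sum_f_R0 (a n) (K n) - L) with
    ((sum_f_R0 (a n) (K n) - sum_f_R0 (a n) p) + ((sum_f_R0 (a n) p - sum_f_R0 l p) + - (L - sum_f_R0 l p))) by ring.
  eapply Rle_lt_trans; [apply Rabs_triang|].
  eapply Rle_lt_trans; [apply Rplus_le_compat_l, Rabs_triang|].
  rewrite Rabs_Ropp. lra.
Qed.

(** Comparison with the geometric series of ratio [exp (- c)]. The exponent [p] is kept general to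
    serve both [odd_sq] and [j * j]. *)
Lemma gaussian_summable (c : R) (p : nat -> R) : 0 < c -> (forall k, INR k <= p k) ->
  exists S : R, is_lim_seq (sum_f_R0 (fun k => exp (- (c * p k)))) S.
Proof.
  intros Hc Hp.
  assert (E : ex_series (fun k => exp (- (c * p k)))).
  { apply (@ex_series_le R_AbsRing R_CompleteNormedModule _ (fun k => exp (- c) ^ k)).
    - intro k. unfold norm; cbn; unfold abs; cbn.
      rewrite Rabs_pos_eq by (left; apply exp_pos).
      rewrite exp_opp_pow. apply exp_le, Ropp_le_contravar.
      pose proof (Hp k); nra.
    - apply ex_series_geom. rewrite Rabs_pos_eq by (left; apply exp_pos).
      rewrite <- exp_0; apply exp_increasing; lra. }
  destruct E as [S HS]. exists S.
  apply (is_lim_seq_ext _ _ _ (fun n => sum_n_Reals _ n)). exact HS.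
Qed.

Lemma dominated_summable (a M : nat -> R) (S : R) : is_lim_seq (sum_f_R0 M) S ->
  (forall k, Rabs (a k) <= M k) -> exists L : R, is_lim_seq (sum_f_R0 a) L.
Proof.
  intros HM Ha.
  assert (E : ex_series a).
  { apply (@ex_series_le R_AbsRing R_CompleteNormedModule _ M); [exact Ha|]. exists S.
    apply (is_lim_seq_ext (sum_f_R0 M) (sum_n M) S (fun n => eq_sym (sum_n_Reals M n))). exact HM. }
  destruct E as [L HL]. exists L.
  apply (is_lim_seq_ext _ _ _ (fun n => sum_n_Reals _ n)). exact HL.
Qed.

(** * The series of [theta_o] *)

Lemma theta_o_partial_bisum s N : theta_o_partial s N = bisum (theta_o_term s) N.
Proof.
  unfold theta_o_partial. rewrite map_map.
  assert (App : forall u v : list R, fold_right Rplus 0 (u ++ v) = fold_right Rplus 0 u + fold_right Rplus 0 v).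
  { intros u v; induction u as [|x u IH]; cbn; [|rewrite IH]; ring. }
  induction N as [|N IH].
  - cbn. ring.
  - replace (2 * S N + 1)%nat with (S (2 * N + 1 + 1)) by lia.
    cbn [seq map fold_right]. rewrite seq_app, map_app, App, <- seq_shift, map_map.
    cbn [seq map fold_right bisum]. rewrite <- IH.
    rewrite (map_ext (fun x => theta_o_term s (Z.of_nat (S x) - Z.of_nat (S N)))
       (fun x => theta_o_term s (Z.of_nat x - Z.of_nat N))).
    2:{ intro x; f_equal; lia. }
    replace (Z.of_nat 0 - Z.of_nat (S N))%Z with (- Z.of_nat (S N))%Z by lia.
    replace (Z.of_nat (1 + (2 * N + 1)) - Z.of_nat (S N))%Z with (Z.of_nat (S N)) by lia.
    ring.
Qed.

Definition odd_sq (k : nat) : R := INR (2 * k + 1) ^ 2.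

Lemma odd_sq_ge k : INR k <= odd_sq k.
Proof.
  unfold odd_sq. rewrite plus_INR, mult_INR; cbn [INR]. pose proof (pos_INR k). nra.
Qed.

(** The indices [k] and [- k - 1] give equal terms, so a symmetric partial sum is twice the
    one-sided sum minus its last term, which tends to zero. *)
Lemma theta_o_series s : 0 < s ->
  is_lim_seq (sum_f_R0 (fun k => exp (- (PI * s * odd_sq k)))) (theta_o s / 2).
Proof.
  intro Hs. pose proof PI_RGT_0.
  destruct (gaussian_summable (PI * s) odd_sq) as [S HS];
    [apply Rmult_lt_0_compat; lra | apply odd_sq_ge |].
  assert (E : forall k, theta_o_term s (Z.of_nat k) = exp (- (PI * s * odd_sq k))).
  { intro k; unfold theta_o_term, odd_sq. f_equal.
    rewrite (INR_IZR_INZ (2 * k + 1)).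
    replace (Z.of_nat (2 * k + 1)) with (2 * Z.of_nat k + 1)%Z by lia. ring. }
  assert (C : Un_cv (theta_o_partial s) (2 * S)).
  { apply is_lim_seq_Reals.
    apply (is_lim_seq_ext_loc (fun N => 2 * sum_f_R0 (fun k => exp (- (PI * s * odd_sq k))) N
      - exp (- (PI * s * odd_sq N)))).
    { exists O; intros N _. rewrite theta_o_partial_bisum, bisum_reflect.
      - rewrite E. f_equal. f_equal. apply sum_eq; intros; rewrite E; reflexivity.
      - intro k. unfold theta_o_term. f_equal.
        replace (2 * - (k + 1) + 1)%Z with (- (2 * k + 1))%Z by lia.
        rewrite opp_IZR. ring. }
    replace (Finite (2 * S)) with (Finite (2 * S - 0)) by (f_equal; ring).
    apply is_lim_seq_minus'.
    - apply is_lim_seq_mult'; [apply is_lim_seq_const | exact HS].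
    - apply is_lim_seq_incr_1.
      apply (is_lim_seq_ext (fun n => sum_f_R0 (fun k => exp (- (PI * s * odd_sq k))) (Datatypes.S n)
         - sum_f_R0 (fun k => exp (- (PI * s * odd_sq k))) n)).
      { intro n; cbn [sum_f_R0]; ring. }
      replace (Finite 0) with (Finite (S - S)) by (f_equal; ring).
      apply is_lim_seq_minus'; [|exact HS].
      apply (is_lim_seq_incr_1 (sum_f_R0 (fun k => exp (- (PI * s * odd_sq k))))), HS. }
  (* Convergence makes the [epsilon] choice a genuine limit, and uniqueness of limits identifies
     it. *)
  assert (V : theta_o s = 2 * S).
  { apply (UL_sequence (theta_o_partial s)); [|exact C].
    unfold theta_o. apply epsilon_spec. exists (2 * S); exact C. }
  rewrite V. replace (2 * S / 2) with S by field. exact HS.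
Qed.

Lemma theta_o_pos s : 0 < s -> 0 < theta_o s.
Proof.
  intro Hs. pose proof (theta_o_series s Hs) as H.
  apply is_lim_seq_incr_compare with (n := O) in H.
  - cbn [sum_f_R0] in H. pose proof (exp_pos (- (PI * s * odd_sq 0))). lra.
  - intro n; cbn [sum_f_R0]. pose proof (exp_pos (- (PI * s * odd_sq (S n)))). lra.
Qed.

(** * Limits of the two sides of Polya's identity *)

Lemma cos_bounds x : 0 <= x <= PI / 2 ->
  1 - x ^ 2 / 2 <= cos x <= 1 - x ^ 2 / 2 + x ^ 4 / 24.
Proof.
  intro H. pose proof (cos_bound x 0 ltac:(lra) ltac:(lra)) as B.
  unfold cos_approx, cos_term in B. cbn in B. lra.
Qed.

(** On this interval [x ^ 2 <= 4], so [x ^ 4 / 24 <= x ^ 2 / 6], which leaves [1 - x ^ 2 / 3] as an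
    upper bound for the cosine. *)
Lemma cos_le_exp x : 0 <= x <= PI / 2 -> cos x <= exp (- (x ^ 2 / 3)).
Proof.
  intro H. pose proof (cos_bounds x H). pose proof PI_4.
  eapply Rle_trans; [|apply one_minus_le_exp].
  assert (x ^ 2 <= 4) by nra. replace (x ^ 4) with (x ^ 2 * x ^ 2) in * by ring.
  pose proof (pow2_ge_0 x). nra.
Qed.

(* With [m = n + 1] steps the cycle has length [2 (cell s n + 1)], where
   [(cell s n + 1) ^ 2 / m] tends to [PI * s]. *)
Definition cell (s : R) (n : nat) : nat :=
  pred (Z.to_nat (up (sqrt (PI * s) * sqrt (INR (S n))))).

Lemma cell_bounds s n : 0 < s ->
  sqrt (PI * s) * sqrt (INR (S n)) < INR (S (cell s n)) <= sqrt (PI * s) * sqrt (INR (S n)) + 1.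
Proof.
  intro Hs. unfold cell.
  set (x := sqrt (PI * s) * sqrt (INR (S n))).
  assert (Hx : 0 <= x) by (apply Rmult_le_pos; apply sqrt_pos).
  destruct (archimed x) as [H1 H2].
  (* Positivity of [up x] means that neither [Z.to_nat] nor [pred] truncates. *)
  assert (P : (0 < up x)%Z) by (apply lt_IZR; lra).
  replace (S (Init.Nat.pred (Z.to_nat (up x)))) with (Z.to_nat (up x)) by lia.
  rewrite INR_IZR_INZ, Z2Nat.id by lia. lra.
Qed.

Lemma inv_sqrt_lim : is_lim_seq (fun n => / sqrt (INR (S n))) 0.
Proof.
  apply (is_lim_seq_ext (fun n => sqrt (/ INR (S n)))).
  { intro n; apply sqrt_inv. }
  rewrite <- sqrt_0. apply is_lim_seq_continuous; [apply continuity_pt_sqrt; lra|].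
  replace (Finite 0) with (Rbar_inv p_infty) by reflexivity.
  apply is_lim_seq_inv; [|discriminate].
  apply (is_lim_seq_incr_1 INR), is_lim_seq_INR.
Qed.

Lemma cell_lim s : 0 < s ->
  is_lim_seq (fun n => INR (S (cell s n)) / sqrt (INR (S n))) (sqrt (PI * s)).
Proof.
  intro Hs.
  apply (is_lim_seq_le_le (fun _ => sqrt (PI * s)) _ (fun n => sqrt (PI * s) + / sqrt (INR (S n)))).
  - intro n. pose proof (cell_bounds s n Hs) as B.
    pose proof (sqrt_lt_R0 (INR (S n)) (lt_0_INR (S n) ltac:(lia))) as P.
    pose proof (Rinv_0_lt_compat _ P).
    set (g := sqrt (INR (S n))) in *. split.
    + apply (Rmult_le_reg_r g); [exact P|]. unfold Rdiv. rewrite Rmult_assoc, Rinv_l; lra.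
    + apply (Rmult_le_reg_r g); [exact P|]. unfold Rdiv.
      rewrite Rmult_assoc, Rmult_plus_distr_r, Rinv_l; lra.
  - apply is_lim_seq_const.
  - replace (Finite (sqrt (PI * s))) with (Finite (sqrt (PI * s) + 0)) by (f_equal; ring).
    apply is_lim_seq_plus'; [apply is_lim_seq_const | apply inv_sqrt_lim].
Qed.

Lemma is_lim_seq_exp_opp (u : nat -> R) (l : R) :
  is_lim_seq u l -> is_lim_seq (fun n => exp (- u n)) (exp (- l)).
Proof.
  intro H. apply (is_lim_seq_continuous exp (fun n => - u n) (- l)).
  - apply derivable_continuous_pt, derivable_pt_exp.
  - apply (is_lim_seq_opp u l), H.
Qed.

Lemma eventually_lt (u : nat -> R) (l c : R) :
  is_lim_seq u l -> l < c -> eventually (fun n => u n < c).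
Proof.
  intros H Hc. apply is_lim_seq_spec in H.
  generalize (H (mkposreal (c - l) ltac:(lra))). apply filter_imp.
  intros n Hn; cbn in Hn. apply Rabs_def2 in Hn. lra.
Qed.

(** Local limit theorem at the distance [A = (cell s n + 1) (2 k + 1)]. The bounds [walk_lower] and
    [walk_upper] with [m = n + 1] have exponents [A ^ 2 / (m - A)] and [A ^ 2 / (m + A)]; since
    [A / m], written [u n * p * r n], tends to zero, both tend to [PI * s * odd_sq k]. *)
Lemma walk_odd_lim s k : 0 < s ->
  is_lim_seq (fun n => walk (S n) (Z.of_nat (S (cell s n) * (2 * k + 1))) / walk (S n) 0)
    (exp (- (PI * s * odd_sq k))).
Proof.
  intro Hs. pose proof PI_RGT_0.
  set (u := fun n => INR (S (cell s n)) / sqrt (INR (S n))).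
  set (r := fun n => / sqrt (INR (S n))).
  set (p := INR (2 * k + 1)).
  assert (Hu : is_lim_seq u (sqrt (PI * s))) by (exact (cell_lim s Hs)).
  assert (Hr : is_lim_seq r 0) by apply inv_sqrt_lim.
  assert (Hup : is_lim_seq (fun n => u n * p * r n) 0).
  { replace (Finite 0) with (Finite (sqrt (PI * s) * p * 0)) by (f_equal; ring).
    apply is_lim_seq_mult'; [apply is_lim_seq_mult'|]; trivial. apply is_lim_seq_const. }
  assert (Hu2 : is_lim_seq (fun n => (u n * p) ^ 2) (PI * s * odd_sq k)).
  { apply (is_lim_seq_ext (fun n => (u n * p) * (u n * p))); [intro; ring|].
    replace (PI * s * odd_sq k) with (sqrt (PI * s) * p * (sqrt (PI * s) * p)).
    - apply is_lim_seq_mult'; (apply is_lim_seq_mult'; [exact Hu | apply is_lim_seq_const]).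
    - transitivity (sqrt (PI * s) * sqrt (PI * s) * (p * p)); [ring|].
      rewrite sqrt_sqrt by nra. unfold odd_sq, p; ring. }
  assert (Q : forall e, is_lim_seq (fun n => exp (- ((u n * p) ^ 2 / (1 + e * (u n * p * r n)))))
                (exp (- (PI * s * odd_sq k)))).
  { intro e. apply is_lim_seq_exp_opp.
    replace (PI * s * odd_sq k) with (PI * s * odd_sq k / (1 + e * 0)) by field.
    apply is_lim_seq_div'; [exact Hu2 | | lra].
    apply is_lim_seq_plus'; [apply is_lim_seq_const|].
    apply is_lim_seq_mult'; [apply is_lim_seq_const | exact Hup]. }
  refine (is_lim_seq_le_le_loc _ _ _ _ _ (Q (-1)) (Q 1)).
  (* Eventually [A / m < 1], as [walk_lower] demands. *)
  generalize (eventually_lt _ _ 1 Hup Rlt_0_1). apply filter_imp. intros n Hn.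
  set (A := (S (cell s n) * (2 * k + 1))%nat).
  pose proof (lt_0_INR (S n) ltac:(lia)) as Pn.
  pose proof (sqrt_lt_R0 _ Pn) as Pg.
  assert (EA : INR A = u n * p * sqrt (INR (S n))).
  { unfold A, u, p. rewrite mult_INR. field. lra. }
  assert (Em : INR (S n) = sqrt (INR (S n)) * sqrt (INR (S n))) by (rewrite sqrt_sqrt; lra).
  unfold r in *. set (g := sqrt (INR (S n))) in *.
  assert (PA : 0 <= INR A) by apply pos_INR.
  assert (Hup0 : 0 <= u n * p).
  { rewrite EA in PA. destruct (Rle_dec 0 (u n * p)); [assumption | nra]. }
  assert (HA : (A < S n)%nat).
  { apply INR_lt. rewrite EA, Em. apply Rmult_lt_compat_r; [exact Pg|].
    apply (Rmult_lt_compat_r g) in Hn; [|exact Pg].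
    rewrite Rmult_assoc, Rinv_l in Hn; lra. }
  assert (Hinv : 0 < / g) by (apply Rinv_0_lt_compat, Pg).
  assert (Hlt : u n * p < g).
  { apply (Rmult_lt_reg_r (/ g)); [exact Hinv|]. rewrite Rinv_r; lra. }
  pose proof (walk_lower (S n) A A HA (Nat.le_refl A)) as L.
  pose proof (walk_upper (S n) A A ltac:(lia) (Nat.le_refl A) ltac:(lia)) as U.
  rewrite EA, Em in L, U.
  replace ((u n * p * g) ^ 2 / (g * g - u n * p * g))
    with ((u n * p) ^ 2 / (1 + -1 * (u n * p * / g))) in L by (field; nra).
  replace ((u n * p * g) ^ 2 / (g * g + u n * p * g))
    with ((u n * p) ^ 2 / (1 + 1 * (u n * p * / g))) in U by (field; nra).
  pose proof (walk0_pos (S n)) as W.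
  split; apply (Rmult_le_reg_l (walk (S n) 0)); trivial.
  - replace (walk (S n) 0 * (walk (S n) (Z.of_nat A) / walk (S n) 0))
      with (walk (S n) (Z.of_nat A)) by (field; lra). exact L.
  - replace (walk (S n) 0 * (walk (S n) (Z.of_nat A) / walk (S n) 0))
      with (walk (S n) (Z.of_nat A)) by (field; lra). exact U.
Qed.

(** Within reach of the walk, [walk_upper] with [A] replaced by the number of steps has denominator
    [2 m], which halves the limiting exponent uniformly in [n]; out of reach the walk vanishes. *)
Lemma walk_odd_bound s n k : 0 < s ->
  Rabs (walk (S n) (Z.of_nat (S (cell s n) * (2 * k + 1))) / walk (S n) 0) <=
  exp (- (PI * s / 2 * odd_sq k)).
Proof.
  intro Hs. pose proof PI_RGT_0. pose proof (walk0_pos (S n)) as W.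
  set (A := (S (cell s n) * (2 * k + 1))%nat).
  rewrite Rabs_pos_eq by (apply Rdiv_le_0_compat; [apply walk_nonneg | exact W]).
  apply (Rmult_le_reg_l (walk (S n) 0)); [exact W|].
  replace (walk (S n) 0 * (walk (S n) (Z.of_nat A) / walk (S n) 0))
    with (walk (S n) (Z.of_nat A)) by (field; lra).
  destruct (Nat.le_gt_cases A (S n)) as [h | h].
  - eapply Rle_trans; [apply (walk_upper (S n) (S n)); lia|].
    apply Rmult_le_compat_l; [lra|]. apply exp_le, Ropp_le_contravar.
    pose proof (cell_bounds s n Hs) as [B _].
    pose proof (lt_0_INR (S n) ltac:(lia)) as Pn.
    assert (B2 : PI * s * INR (S n) <= INR (S (cell s n)) ^ 2).
    { assert (E : PI * s * INR (S n) = (sqrt (PI * s) * sqrt (INR (S n))) ^ 2).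
      { rewrite Rpow_mult_distr, !pow2_sqrt; nra. }
      rewrite E. apply pow_incr. split; [|lra].
      apply Rmult_le_pos; apply sqrt_pos. }
    unfold A, odd_sq. rewrite mult_INR, Rpow_mult_distr.
    apply (Rmult_le_reg_r (2 * INR (S n))); [lra|].
    replace (INR (S (cell s n)) ^ 2 * INR (2 * k + 1) ^ 2 / (INR (S n) + INR (S n)) * (2 * INR (S n)))
      with (INR (S (cell s n)) ^ 2 * INR (2 * k + 1) ^ 2) by (field; lra).
    replace (PI * s / 2 * INR (2 * k + 1) ^ 2 * (2 * INR (S n)))
      with (PI * s * INR (S n) * INR (2 * k + 1) ^ 2) by field.
    apply Rmult_le_compat_r; [apply pow2_ge_0 | exact B2].
  - rewrite walk_out by lia. apply Rmult_le_pos; [lra | left; apply exp_pos].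
Qed.

Lemma walk_sum_lim s : 0 < s ->
  is_lim_seq (fun n => sum_f_R0 (fun k =>
     walk (S n) (Z.of_nat (S (cell s n) * (2 * k + 1))) / walk (S n) 0) (S (S n)))
    (theta_o s / 2).
Proof.
  intro Hs. pose proof PI_RGT_0.
  destruct (gaussian_summable (PI * s / 2) odd_sq ltac:(nra) odd_sq_ge) as [M HM].
  eapply (tannery _ (fun k => exp (- (PI * s * odd_sq k))) _ (fun n => S (S n)) _ _ HM).
  - intros n k _. apply walk_odd_bound, Hs.
  - intro k. rewrite Rabs_pos_eq by (left; apply exp_pos).
    apply exp_le, Ropp_le_contravar.
    assert (0 <= odd_sq k) by apply pow2_ge_0.
    apply Rmult_le_compat_r; [assumption | nra].
  - apply theta_o_series, Hs.
  - intro p; exists p; intros; lia.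
  - intro k; apply walk_odd_lim, Hs.
Qed.

(** For [x = PI j / (2 (cell s n + 1))] and [m = n + 1] steps, [cos x ^ (2 m)] behaves like
    [exp (- m x ^ 2)], and [m x ^ 2] tends to [PI ^ 2 j ^ 2 / (4 PI s)]. *)
Lemma cos_pow_lim s j : 0 < s ->
  is_lim_seq (fun n => cos (PI * INR j / (2 * INR (S (cell s n)))) ^ (2 * S n))
    (exp (- (INR (j * j) * (PI / (4 * s))))).
Proof.
  intro Hs. pose proof PI_RGT_0.
  set (x := fun n => PI * INR j / (2 * INR (S (cell s n)))).
  set (u := fun n => INR (S (cell s n)) / sqrt (INR (S n))).
  assert (Hu : is_lim_seq u (sqrt (PI * s))) by (exact (cell_lim s Hs)).
  assert (Pps : 0 < PI * s) by nra. pose proof (sqrt_lt_R0 _ Pps) as Psq.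
  assert (Xpos : forall n, 0 <= x n).
  { intro n. apply Rdiv_le_0_compat; [apply Rmult_le_pos; [lra | apply pos_INR]|].
    pose proof (lt_0_INR (S (cell s n)) ltac:(lia)); lra. }
  set (y := fun n => PI * INR j / (2 * u n)).
  assert (Hy : is_lim_seq y (PI * INR j / (2 * sqrt (PI * s)))).
  { apply is_lim_seq_div'; [apply is_lim_seq_const | | lra].
    apply is_lim_seq_mult'; [apply is_lim_seq_const | exact Hu]. }
  assert (Exy : forall n, x n = y n * / sqrt (INR (S n))).
  { intro n. unfold x, y, u. pose proof (lt_0_INR (S (cell s n)) ltac:(lia)).
    pose proof (sqrt_lt_R0 _ (lt_0_INR (S n) ltac:(lia))). field; lra. }
  assert (Hx : is_lim_seq x 0).
  { apply (is_lim_seq_ext (fun n => y n * / sqrt (INR (S n)))); [intro; symmetry; apply Exy|].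
    replace (Finite 0) with (Finite (PI * INR j / (2 * sqrt (PI * s)) * 0)) by (f_equal; ring).
    apply is_lim_seq_mult'; [exact Hy | apply inv_sqrt_lim]. }
  assert (Hx2 : is_lim_seq (fun n => x n ^ 2) 0).
  { apply (is_lim_seq_ext (fun n => x n * x n)); [intro; ring|].
    replace (Finite 0) with (Finite (0 * 0)) by (f_equal; ring).
    apply is_lim_seq_mult'; exact Hx. }
  assert (Hmx : is_lim_seq (fun n => INR (S n) * x n ^ 2) (INR (j * j) * (PI / (4 * s)))).
  { apply (is_lim_seq_ext (fun n => y n * y n)).
    { intro n. rewrite Exy. pose proof (lt_0_INR (S n) ltac:(lia)) as P.
      pose proof (sqrt_lt_R0 _ P).
      rewrite <- (sqrt_sqrt (INR (S n))) at 1 by lra. field; lra. }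
    replace (INR (j * j) * (PI / (4 * s))) with
      (PI * INR j / (2 * sqrt (PI * s)) * (PI * INR j / (2 * sqrt (PI * s)))).
    - apply is_lim_seq_mult'; exact Hy.
    - transitivity (PI * INR j * (PI * INR j) / (4 * (sqrt (PI * s) * sqrt (PI * s)))); [field; lra|].
      rewrite sqrt_sqrt, mult_INR by lra. field; lra. }
  (* Lower envelope, from [1 - x ^ 2 / 2 <= cos x] and [exp_le_one_minus]. *)
  assert (QL : is_lim_seq (fun n => exp (- (INR (S n) * x n ^ 2 / (1 - x n ^ 2 / 2))))
                 (exp (- (INR (j * j) * (PI / (4 * s)))))).
  { apply is_lim_seq_exp_opp.
    replace (INR (j * j) * (PI / (4 * s))) with (INR (j * j) * (PI / (4 * s)) / (1 - 0 / 2))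
      by (field; lra).
    apply is_lim_seq_div'; [exact Hmx | | lra].
    apply is_lim_seq_minus'; [apply is_lim_seq_const|].
    apply is_lim_seq_div'; [exact Hx2 | apply is_lim_seq_const | lra]. }
  (* Upper envelope, from [cos x <= 1 - (x ^ 2 / 2 - x ^ 4 / 24)] and [one_minus_le_exp]. *)
  assert (QU : is_lim_seq (fun n => exp (- (INR (S n) * x n ^ 2 * (1 - x n ^ 2 / 12))))
                 (exp (- (INR (j * j) * (PI / (4 * s)))))).
  { apply is_lim_seq_exp_opp.
    replace (INR (j * j) * (PI / (4 * s))) with (INR (j * j) * (PI / (4 * s)) * (1 - 0 / 12))
      by (field; lra).
    apply is_lim_seq_mult'; [exact Hmx|].
    apply is_lim_seq_minus'; [apply is_lim_seq_const|].
    apply is_lim_seq_div'; [exact Hx2 | apply is_lim_seq_const | lra]. }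
  refine (is_lim_seq_le_le_loc _ _ _ _ _ QL QU).
  generalize (eventually_lt _ _ 1 Hx Rlt_0_1). apply filter_imp. intros n Hn.
  fold (x n). pose proof (Xpos n). pose proof PI2_1.
  pose proof (cos_bounds (x n) ltac:(lra)) as [CL CU].
  assert (x n ^ 2 < 1) by nra.
  assert (E2 : INR (2 * S n) = 2 * INR (S n)) by (rewrite mult_INR; reflexivity).
  split.
  - replace (- (INR (S n) * x n ^ 2 / (1 - x n ^ 2 / 2)))
      with (- (INR (2 * S n) * (x n ^ 2 / 2 / (1 - x n ^ 2 / 2)))) by (rewrite E2; field; lra).
    rewrite <- exp_opp_pow. apply pow_incr. split; [left; apply exp_pos|].
    eapply Rle_trans; [apply exp_le_one_minus; lra | lra].
  - replace (- (INR (S n) * x n ^ 2 * (1 - x n ^ 2 / 12)))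
      with (- (INR (2 * S n) * (x n ^ 2 / 2 - x n ^ 4 / 24))) by (rewrite E2; field).
    rewrite <- exp_opp_pow. apply pow_incr. split; [lra|].
    eapply Rle_trans; [|apply one_minus_le_exp]. lra.
Qed.

(** The condition on [j] keeps the angle in [[0, PI / 2]], where [cos_le_exp] applies; the constant
    then comes from the upper bound [L2] for the squared half-length of the cycle. *)
Lemma cos_pow_bound s n j : 0 < s -> (j <= cell s n)%nat ->
  Rabs ((-1) ^ j * cos (PI * INR j / (2 * INR (S (cell s n)))) ^ (2 * S n)) <=
  exp (- (PI ^ 2 / (12 * (PI * s + 1)) * INR (j * j))).
Proof.
  intros Hs Hj. pose proof PI_RGT_0.
  rewrite Rabs_mult, pow_1_abs, Rmult_1_l.
  pose proof (cell_bounds s n Hs) as [_ B].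
  pose proof (lt_0_INR (S (cell s n)) ltac:(lia)) as Pl.
  assert (Pn : 1 <= INR (S n)) by (rewrite S_INR; pose proof (pos_INR n); lra).
  apply le_INR in Hj. pose proof (pos_INR j).
  set (l := INR (S (cell s n))) in *.
  assert (Hl : INR j <= l) by (unfold l; rewrite S_INR; lra).
  set (x := PI * INR j / (2 * l)).
  assert (Hx : 0 <= x <= PI / 2).
  { split.
    - apply Rdiv_le_0_compat; nra.
    - apply (Rmult_le_reg_r (2 * l)); [lra|]. unfold x.
      replace (PI * INR j / (2 * l) * (2 * l)) with (PI * INR j) by (field; lra).
      replace (PI / 2 * (2 * l)) with (PI * l) by field. nra. }
  pose proof (cos_le_exp x Hx) as C.
  pose proof (cos_ge_0 x ltac:(lra) ltac:(lra)) as C0.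
  rewrite Rabs_pos_eq by (apply pow_le, C0).
  eapply Rle_trans; [apply pow_incr; split; [exact C0 | exact C]|].
  rewrite exp_opp_pow. apply exp_le, Ropp_le_contravar.
  (* From [l <= z + 1] follows [l ^ 2 <= 2 z ^ 2 + 2], and [2 <= 2 * INR (S n)]. *)
  assert (L2 : l ^ 2 <= 2 * (PI * s + 1) * INR (S n)).
  { assert (E : (sqrt (PI * s) * sqrt (INR (S n))) ^ 2 = PI * s * INR (S n)).
    { rewrite Rpow_mult_distr, !pow2_sqrt; nra. }
    set (z := sqrt (PI * s) * sqrt (INR (S n))) in *.
    assert (l ^ 2 <= (z + 1) ^ 2) by (apply pow_incr; lra).
    pose proof (pow2_ge_0 (z - 1)). nra. }
  rewrite !mult_INR. unfold x. replace (INR 2) with 2 by (cbn; ring).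
  assert (0 < PI * s) by nra.
  apply (Rmult_le_reg_r (12 * (PI * s + 1) * l ^ 2)).
  { apply Rmult_lt_0_compat; [lra | apply pow_lt, Pl]. }
  replace (PI ^ 2 / (12 * (PI * s + 1)) * (INR j * INR j) * (12 * (PI * s + 1) * l ^ 2))
    with (PI ^ 2 * (INR j * INR j) * l ^ 2) by (field; lra).
  replace (2 * INR (S n) * ((PI * INR j / (2 * l)) ^ 2 / 3) * (12 * (PI * s + 1) * l ^ 2))
    with (PI ^ 2 * (INR j * INR j) * (2 * (PI * s + 1) * INR (S n))) by (field; lra).
  apply Rmult_le_compat_l; [|exact L2].
  apply Rmult_le_pos; [apply pow2_ge_0 | nra].
Qed.

Lemma INR_le_sq j : INR j <= INR (j * j).
Proof. apply le_INR; nia. Qed.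

Lemma cell_unbounded s p : 0 < s -> eventually (fun n => (p <= cell s n)%nat).
Proof.
  intro Hs. pose proof PI_RGT_0.
  assert (Pps : 0 < PI * s) by nra. pose proof (sqrt_lt_R0 _ Pps) as Psq.
  assert (Hp : is_lim_seq (fun n => (INR p + 1) * / sqrt (INR (S n))) 0).
  { replace (Finite 0) with (Finite ((INR p + 1) * 0)) by (f_equal; ring).
    apply is_lim_seq_mult'; [apply is_lim_seq_const | apply inv_sqrt_lim]. }
  generalize (eventually_lt _ _ _ Hp Psq). apply filter_imp. intros n Hn.
  pose proof (cell_bounds s n Hs) as [B _].
  pose proof (sqrt_lt_R0 _ (lt_0_INR (S n) ltac:(lia))) as P.
  apply (Rmult_lt_compat_r (sqrt (INR (S n)))) in Hn; [|exact P].
  rewrite Rmult_assoc, Rinv_l, Rmult_1_r in Hn by lra.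
  rewrite (S_INR (cell s n)) in B. apply INR_le. lra.
Qed.

(** * Jacobi's transformation and conclusion *)

Definition nome (s : R) : R := exp (- (PI / (4 * s))).

Lemma nome_unit s : 0 < s -> 0 < nome s < 1.
Proof.
  intro Hs. unfold nome; split; [apply exp_pos|].
  rewrite <- exp_0. apply exp_increasing. pose proof PI_RGT_0.
  assert (0 < PI / (4 * s)) by (apply Rdiv_lt_0_compat; lra). lra.
Qed.

Lemma nome_pow s n : nome s ^ n = exp (- (INR n * (PI / (4 * s)))).
Proof. apply exp_opp_pow. Qed.

(** Here [T] is the bilateral sum [theta_4]; counting [j = 0] once, the one-sided sum is
    [(T + 1) / 2]. *)
Lemma theta_4_ex s : 0 < s -> exists T : R,
  is_lim_seq (sum_f_R0 (fun j => (-1) ^ j * nome s ^ (j * j))) ((T + 1) / 2).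
Proof.
  intro Hs. pose proof PI_RGT_0.
  destruct (gaussian_summable (PI / (4 * s)) (fun j => INR (j * j))) as [M HM].
  { apply Rdiv_lt_0_compat; lra. } { apply INR_le_sq. }
  destruct (dominated_summable (fun j => (-1) ^ j * nome s ^ (j * j)) _ M HM) as [L HL].
  - intro k. rewrite Rabs_mult, pow_1_abs, Rmult_1_l, nome_pow.
    rewrite Rabs_pos_eq by (left; apply exp_pos). right; f_equal; ring.
  - exists (2 * L - 1). replace ((2 * L - 1 + 1) / 2) with L by field. exact HL.
Qed.

Lemma cos_sum_lim s T : 0 < s ->
  is_lim_seq (sum_f_R0 (fun j => (-1) ^ j * nome s ^ (j * j))) ((T + 1) / 2) ->
  is_lim_seq (fun n => sum_f_R0 (fun j =>
    (-1) ^ j * cos (PI * INR j / (2 * INR (S (cell s n)))) ^ (2 * S n)) (cell s n)) ((T + 1) / 2).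
Proof.
  intros Hs HT. pose proof PI_RGT_0.
  set (c := PI ^ 2 / (12 * (PI * s + 1))).
  assert (Pps : 0 < PI * s) by nra.
  assert (Hc : 0 < c) by (apply Rdiv_lt_0_compat; [apply pow_lt |]; lra).
  destruct (gaussian_summable c (fun j => INR (j * j)) Hc INR_le_sq) as [M HM].
  assert (Lim : forall j, is_lim_seq (fun n => (-1) ^ j *
     cos (PI * INR j / (2 * INR (S (cell s n)))) ^ (2 * S n)) ((-1) ^ j * nome s ^ (j * j))).
  { intro j. apply is_lim_seq_mult'; [apply is_lim_seq_const|].
    rewrite nome_pow. apply cos_pow_lim, Hs. }
  eapply (tannery _ (fun j => (-1) ^ j * nome s ^ (j * j)) _ (cell s) _ _ HM).
  - intros n j Hj. apply cos_pow_bound; assumption.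
  - intro j.
    (* The limit terms inherit the majorant, since [cos_pow_bound] holds for all large [n] once [j]
       is fixed. *)
    refine (is_lim_seq_le_loc _ _ (Rabs _) (exp (- (c * INR (j * j)))) _
      (is_lim_seq_abs _ _ (Lim j)) (is_lim_seq_const _)).
    generalize (cell_unbounded s j Hs). apply filter_imp. intros n Hn.
    apply cos_pow_bound; assumption.
  - exact HT.
  - intro p; apply cell_unbounded, Hs.
  - exact Lim.
Qed.

(* The left-hand side does not depend on [s]: this is Jacobi's transformation
   [theta_4 (1/(4s)) = C * sqrt s * theta_o s] with an unspecified constant. *)
Lemma central_walk_lim s T : 0 < s ->
  is_lim_seq (sum_f_R0 (fun j => (-1) ^ j * nome s ^ (j * j))) ((T + 1) / 2) ->
  is_lim_seq (fun n => sqrt (INR (S n)) * walk (S n) 0) (T / (2 * (sqrt (PI * s) * theta_o s))).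
Proof.
  intros Hs HT. pose proof PI_RGT_0.
  assert (Pps : 0 < PI * s) by nra. pose proof (sqrt_lt_R0 _ Pps) as Psq.
  pose proof (theta_o_pos s Hs) as Pth.
  set (c := fun n => sum_f_R0 (fun j =>
    (-1) ^ j * cos (PI * INR j / (2 * INR (S (cell s n)))) ^ (2 * S n)) (cell s n)).
  set (w := fun n => sum_f_R0 (fun k =>
     walk (S n) (Z.of_nat (S (cell s n) * (2 * k + 1))) / walk (S n) 0) (S (S n))).
  set (u := fun n => INR (S (cell s n)) / sqrt (INR (S n))).
  assert (Hw : is_lim_seq w (theta_o s / 2)) by (exact (walk_sum_lim s Hs)).
  apply (is_lim_seq_ext_loc (fun n => (2 * c n - 1) / (2 * (u n * (2 * w n))))).
  (* Eventually [w n > 0], so Polya's identity divided by [walk (S n) 0] can be solved for the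
     central probability. *)
  { generalize (eventually_lt (fun n => - w n) (- (theta_o s / 2)) 0
      (proj1 (is_lim_seq_opp w (theta_o s / 2)) Hw) ltac:(lra)).
    apply filter_imp. intros n Hwn. unfold c. rewrite <- polya_identity by lia.
    rewrite (sum_eq _ (fun k => walk (S n) (Z.of_nat (S (cell s n) * (2 * k + 1))) / walk (S n) 0 * walk (S n) 0)).
    2:{ intros k _. field. apply Rgt_not_eq, walk0_pos. }
    rewrite <- scal_sum. fold (w n).
    unfold u. pose proof (lt_0_INR (S (cell s n)) ltac:(lia)).
    pose proof (sqrt_lt_R0 _ (lt_0_INR (S n) ltac:(lia))). field; lra. }
  replace (T / (2 * (sqrt (PI * s) * theta_o s)))
    with ((2 * ((T + 1) / 2) - 1) / (2 * (sqrt (PI * s) * (2 * (theta_o s / 2))))) by (field; lra).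
  apply is_lim_seq_div'.
  - apply is_lim_seq_minus'; [|apply is_lim_seq_const].
    apply is_lim_seq_mult'; [apply is_lim_seq_const|]. exact (cos_sum_lim s T Hs HT).
  - apply is_lim_seq_mult'; [apply is_lim_seq_const|].
    apply is_lim_seq_mult'; [exact (cell_lim s Hs)|].
    apply is_lim_seq_mult'; [apply is_lim_seq_const|]. exact Hw.
  - nra.
Qed.

Theorem mainTheorem13 (r : R) (hr : 0 < r) :
  forall s : R, 0 < s -> theta_o (r * s) * theta_o (r / s) <= theta_o (r * 1) * theta_o (r / 1).
Proof.
  intros s Hs. pose proof PI_RGT_0.
  rewrite Rmult_1_r. replace (r / 1) with r by field.
  assert (H1 : 0 < r * s) by nra.
  assert (H2 : 0 < r / s) by (apply Rdiv_lt_0_compat; assumption).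
  destruct (theta_4_ex (r * s) H1) as [T1 HT1].
  destruct (theta_4_ex (r / s) H2) as [T2 HT2].
  destruct (theta_4_ex r hr) as [T HT].
  (* The exponents [PI / (4 r s)] and [PI s / (4 r)] have geometric mean [PI / (4 r)]; the
     inequality for finite products passes to the limit. *)
  assert (HTT : T1 * T2 <= T * T).
  { refine (is_lim_seq_le _ _ (T1 * T2) (T * T) _
      (is_lim_seq_mult' _ _ _ _ (gauss_square_product _ _ (nome_unit _ H1) HT1)
                                (gauss_square_product _ _ (nome_unit _ H2) HT2))
      (is_lim_seq_mult' _ _ _ _ (gauss_square_product _ _ (nome_unit _ hr) HT)
                                (gauss_square_product _ _ (nome_unit _ hr) HT))).
    intro n.
    replace (gauss_prod (nome r) n * gauss_prod (nome r) n)
      with (gauss_prod (nome r) n ^ 2) by ring.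
    apply gauss_prod_geometric_mean; try (apply Rdiv_lt_0_compat; lra).
    field; lra. }
  pose proof (central_walk_lim _ _ H1 HT1) as W1.
  pose proof (central_walk_lim _ _ H2 HT2) as W2.
  pose proof (central_walk_lim _ _ hr HT) as W.
  (* All three limits concern the same sequence, so the three quotients share one value [C]. *)
  pose proof (is_lim_seq_unique _ _ W1) as E1. rewrite (is_lim_seq_unique _ _ W) in E1.
  pose proof (is_lim_seq_unique _ _ W2) as E2. rewrite (is_lim_seq_unique _ _ W) in E2.
  injection E1 as E1. injection E2 as E2.
  set (C := T / (2 * (sqrt (PI * r) * theta_o r))) in *.
  (* By [walk0_lower] the sequence never drops below [1 / 2], so [C] is positive and may be
     cancelled. *)
  assert (HC : 1 / 2 <= C).
  { refine (is_lim_seq_le (fun _ => 1 / 2) _ (1 / 2) C _ (is_lim_seq_const _) W).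
    intro n. pose proof (walk0_lower n) as L. pose proof (walk0_pos (S n)).
    pose proof (lt_0_INR (S n) ltac:(lia)) as Pn. pose proof (sqrt_lt_R0 _ Pn).
    rewrite <- (sqrt_sqrt (INR (S n))) in L at 1 by lra.
    assert (0 < sqrt (INR (S n)) * walk (S n) 0) by nra. nra. }
  pose proof (theta_o_pos _ H1). pose proof (theta_o_pos _ H2). pose proof (theta_o_pos _ hr).
  assert (P1 : 0 < PI * (r * s)) by nra. assert (P2 : 0 < PI * (r / s)) by nra.
  assert (P : 0 < PI * r) by nra.
  pose proof (sqrt_lt_R0 _ P1) as Q1. pose proof (sqrt_lt_R0 _ P2) as Q2.
  pose proof (sqrt_lt_R0 _ P) as Q.
  assert (F1 : T1 = 2 * C * (sqrt (PI * (r * s)) * theta_o (r * s))) by (rewrite E1; field; lra).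
  assert (F2 : T2 = 2 * C * (sqrt (PI * (r / s)) * theta_o (r / s))) by (rewrite E2; field; lra).
  assert (F : T = 2 * C * (sqrt (PI * r) * theta_o r)) by (unfold C; field; lra).
  assert (SQ : sqrt (PI * (r * s)) * sqrt (PI * (r / s)) = PI * r).
  { rewrite <- sqrt_mult by lra.
    replace (PI * (r * s) * (PI * (r / s))) with ((PI * r) * (PI * r)) by (field; lra).
    apply sqrt_square; lra. }
  (* By [SQ], multiplying by this common factor turns the two sides into [T1 * T2] and [T * T]. *)
  apply (Rmult_le_reg_l (4 * C ^ 2 * (PI * r))).
  { apply Rmult_lt_0_compat; [nra | exact P]. }
  apply Rle_trans with (T1 * T2).
  - right. rewrite F1, F2, <- SQ. ring.
  - eapply Rle_trans; [exact HTT|]. right. rewrite F. clearbody C.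
    rewrite <- (sqrt_sqrt (PI * r)) at 3 by lra. ring.
Qed.
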